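(* Assume the Continuum Hypothesis. For each set $Y\subseteq\{0,1\}^{\mathbb{N}}$ that is not null, there is a Luzin set $L\subseteq\{0,1\}^{\mathbb{N}}$ such that $\{0,1\}^{\mathbb{N}}$ is a Borel image of $L\times Y$; that is, there is a Borel function from $L\times Y$ onto $\{0,1\}^{\mathbb{N}}$.
   Context: $\{0,1\}^{\mathbb{N}}$ is the Cantor space with the product topology; ''null'' refers to the usual (fair coin-tossing) product measure. A set $L\subseteq\{0,1\}^{\mathbb{N}}$ is a Luzin set if its intersection with every meager subset of $\{0,1\}^{\mathbb{N}}$ is countable (has cardinality less than $\aleph_1$). *)

(* Defs.v *)
From HB Require Import structures.
From mathcomp Require Import all_boot all_order all_algebra.
From mathcomp Require Import all_classical all_reals all_analysis.
From mathcomp Require Import zify ring lra.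
Set Implicit Arguments.
Unset Strict Implicit.
Unset Printing Implicit Defensive.
Import Order.TTheory GRing.Theory Num.Theory.
Import numFieldNormedType.Exports.
Local Open Scope classical_set_scope.
Local Open Scope card_scope.
Local Open Scope ring_scope.

Definition continuum_hypothesis : Prop :=
  forall A : set (nat -> bool), countable A \/ A #= [set: nat -> bool].

Definition nowhere_dense (T : topologicalType) (A : set T) : Prop :=
  interior (closure A) = set0.

Definition meager (T : topologicalType) (A : set T) : Prop :=
  exists2 F : nat -> set T,
    (forall n, nowhere_dense (F n)) & A = \bigcup_n F n.

(* A Luzin set is not required to be uncountable. *)
Definition luzin_set (L : set cantor_space) : Prop :=
  forall M : set cantor_space, meager M -> countable (L `&` M).

(* The restriction of f to the subspace A is a Borel map: preimages of Borel
   sets belong to the sigma-algebra on A generated by the relatively open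
   sets.  A is arbitrary, hence measurable_fun A f, which is vacuous when A is
   not measurable, cannot be used. *)
Definition borel_on (T U : topologicalType) (A : set T) (f : T -> U) : Prop :=
  forall B : set U, <<s @open U >> B ->
    <<s A, [set A `&` V | V in @open T] >> (A `&` f @^-1` B).

Definition cantor_borel := g_sigma_algebraType (@open cantor_space).

(* The product measure is the unique Borel measure giving measure 2^-n to the
   basic clopen set determined by a binary word of length n.  Its existence is
   proved below. *)
Definition fair_coin_measure (R : realType)
    (mu : {measure set cantor_borel -> \bar R}) : Prop :=
  forall s : seq bool,
    mu [set x : cantor_space | forall i, (i < size s)%N -> x i = nth false s i]
    = ((2^-1) ^+ size s)%:E.

Section fair_coin_measure_exists.
Context (R : realType).

Let cyl (s : seq bool) : set cantor_space :=
  [set x | forall i, (i < size s)%N -> x i = nth false s i].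

(* digits x lists the binary digits of the fractional part of x. *)
Let digits (x : R) : cantor_space :=
  fun i => odd `|Num.floor (2 ^+ i.+1 * x)|%N.

Let num (s : seq bool) : nat := foldl (fun k (b : bool) => (k.*2 + b)%N) 0%N s.

Let digitsP (x : R) (s : seq bool) : x \in `[0, 1[ ->
  cyl s (digits x) <-> (num s)%:R <= 2 ^+ size s * x < (num s)%:R + 1.
Proof.
rewrite in_itv/= => x01; elim/last_ind: s => [|s b IH].
  by split => // _; rewrite /num/= expr0 mul1r add0r.
have cylE : cyl (rcons s b) (digits x) <->
    cyl s (digits x) /\ digits x (size s) = b.
  rewrite /cyl/= size_rcons; split=> [H|[H1 H2] i].
    split=> [i si|]; last by rewrite (H (size s))// nth_rcons ltnn eqxx.
    by rewrite H ?(ltn_trans si)// nth_rcons si.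
  rewrite ltnS leq_eqVlt => /predU1P[->|si].
    by rewrite nth_rcons ltnn eqxx.
  by rewrite nth_rcons si H1.
have -> : num (rcons s b) = ((num s).*2 + b)%N by rewrite /num foldl_rcons.
rewrite size_rcons natrD -muln2 natrM exprS -mulrA.
set y := 2 ^+ size s * x in IH *.
have yE : 2 ^+ (size s).+1 * x = 2 * y by rewrite exprS mulrA.
apply: (iff_trans cylE); split.
  move=> [/IH /andP[Ny yN] <-]; rewrite /digits yE.
  have /andP[my ym] := floor_itv (2 * y).
  set m := Num.floor (2 * y) in my ym *.
  have h1 : (num s)%:Z * 2 < m + 1.
    by rewrite -(ltr_int R) intrM; apply: le_lt_trans ym; rewrite mulrC ler_pM2l.
  have h2 : m < (num s)%:Z * 2 + 2.
    rewrite -(ltr_int R) intrD intrM; apply: le_lt_trans my _.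
    by rewrite -pmulrn; lra.
  have -> : (num s)%:R * 2 + (odd `|m|%N)%:R = m%:~R :> R.
    have -> : m = ((num s) * 2 + odd `|m|)%N%:Z by lia.
    by rewrite -pmulrn natrD natrM absz_nat oddD oddM andbF/= oddb.
  by rewrite my/=; move: ym; rewrite intrD.
move=> /andP[Ny yN].
have b01 : (0 : R) <= (b : nat)%:R <= (1 : R) by case: (b); rewrite /= ?ler01 ?lexx.
split; first by apply/IH; apply/andP; split; lra.
rewrite /digits yE (_ : Num.floor _ = (num s * 2 + b)%N%:Z); last first.
  by apply: floor_def; rewrite intrD -!pmulrn natrD natrM Ny.
by rewrite absz_nat oddD oddM andbF/= oddb.
Qed.

Let num_lt (s : seq bool) : (num s < 2 ^ size s)%N.
Proof.
elim/last_ind: s => // s b; rewrite /num foldl_rcons size_rcons expnS.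
by rewrite -/(num s); case: b; lia.
Qed.

Let cyl_nbhs (U : set cantor_space) x : open U -> U x ->
  exists2 s, cyl s x & cyl s `<=` U.
Proof.
move=> oU Ux; apply: contrapT => H.
have /choice[y yP] : forall n, exists y : cantor_space,
    cyl (mkseq x n) y /\ ~ U y.
  move=> n; apply: contrapT => Hn; apply: H; exists (mkseq x n).
    by move=> i; rewrite size_mkseq => ni; rewrite nth_mkseq.
  by move=> y cy; apply: contrapT => Uy; apply: Hn; exists y.
have yx : y @ \oo --> x.
  apply/cvg_sup => i; apply/cvg_image.
    by rewrite eqEsubset; split => // b _; exists (fun=> b).
  move=> B /= /nbhs_singleton Bx; exists [set z : nat -> bool | B (z i)].
    exists i.+1 => //= n /= ni; have [+ _] := yP n.
    by move=> /(_ i); rewrite size_mkseq nth_mkseq// => -> //.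
  rewrite eqEsubset; split => [_ [z Bz <-]//|b Bb].
  by exists (fun=> b).
have : (y @ \oo) U by apply: yx; exact: open_nbhs_nbhs.
by case=> N _ /(_ N (leqnn N)); have [_] := yP N.
Qed.

Let measurable_digits : measurable_fun setT (digits : R -> cantor_borel).
Proof.
apply: (@measurability _ _ _ cantor_borel setT digits (@open cantor_space)) => // _ [U oU <-].
rewrite setTI.
have -> : digits @^-1` U =
    \bigcup_(s : seq bool) if `[< cyl s `<=` U >] then digits @^-1` cyl s else set0.
  rewrite eqEsubset; split => [x /(cyl_nbhs oU)[s sx sU]|x [s _]].
    by exists s => //; rewrite asboolT.
  by case: asboolP => // sU /sU.
apply: countable_bigcupT_measurable => // s; case: ifP => // _.
have -> : digits @^-1` cyl s = \bigcap_i
    if (i < size s)%N then [set x | digits x i = nth false s i] else setT.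
  rewrite eqEsubset; split => [x sx i _|x H i si].
    by case: ifP => // /sx.
  by have := H i I; rewrite si.
apply: bigcapT_measurable => i; case: ifP => // _.
have -> : [set x | digits x i = nth false s i] = \bigcup_(k : int)
    if odd `|k|%N == nth false s i
    then [set x | k%:~R <= 2 ^+ i.+1 * x < (k + 1)%:~R] else set0.
  rewrite eqEsubset; split => [x /= sx|x [k _]].
    exists (Num.floor (2 ^+ i.+1 * x)) => //.
    by rewrite -sx /digits eqxx; exact: floor_itv.
  case: eqP => // <- /= kx; rewrite /digits.
  by rewrite (floor_def kx).
apply: countable_bigcupT_measurable => // k; case: ifP => // _.
have e0 : 0 < 2 ^+ i.+1 :> R by rewrite exprn_gt0.
rewrite (_ : [set _ | _] = `[k%:~R / 2 ^+ i.+1, (k + 1)%:~R / 2 ^+ i.+1[%classic).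
  exact: measurable_itv.
by apply/seteqP; split => x /=; rewrite in_itv/= ler_pdivrMr// ltr_pdivlMr//
  ![x * _]mulrC.
Qed.

Lemma fair_coin_measure_exists :
  exists mu : {measure set cantor_borel -> \bar R}, fair_coin_measure mu.
Proof.
have mI : measurable (`[0, 1[%classic : set R) by exact: measurable_itv.
pose nu : {measure set _ -> \bar R} := mrestr (@lebesgue_measure R) mI.
have @mu : {measure set cantor_borel -> \bar R}.
  pose f : {mfun _ >-> _} := mfun_Sub (mem_set measurable_digits).
  exact: (pushforward nu f).
exists mu => s; rewrite /mu/= /pushforward /= /mrestr.
have e0 : 0 < 2 ^+ size s :> R by rewrite exprn_gt0.
have -> : digits @^-1` cyl s `&` `[0, 1[ =
    `[(num s)%:R / 2 ^+ size s, ((num s)%:R + 1) / 2 ^+ size s[%classic.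
  apply/seteqP; split => x /=.
    move=> [/digitsP + x01] => /(_ x01); rewrite in_itv/= ler_pdivrMr//.
    by rewrite ltr_pdivlMr// ![x * _]mulrC.
  rewrite in_itv/= ler_pdivrMr// ltr_pdivlMr// ![x * _]mulrC => H.
  have x01 : x \in `[0, 1[.
    have /andP[H1 H2] := H; rewrite in_itv/= -(pmulr_rge0 _ e0).
    rewrite (le_trans _ H1)//= -(ltr_pM2l e0) mulr1 (lt_le_trans H2)//.
    by rewrite natr1 -natrX ler_nat num_lt.
  by split => //; apply/digitsP.
rewrite lebesgue_measure_itv/= lte_fin ltr_pM2r ?invr_gt0// ltrDl ltr01.
by rewrite -EFinB -mulrBl addrAC subrr add0r mul1r exprVn.
Qed.

End fair_coin_measure_exists.

(* Main.v *)
Require Import Defs.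
From mathcomp Require Import all_boot all_order all_algebra.
From mathcomp Require Import all_classical all_reals all_analysis.
From mathcomp Require Import zify lra wochoice.
Import Order.TTheory GRing.Theory Num.Theory.
Import numFieldNormedType.Exports.
Local Open Scope classical_set_scope.
Local Open Scope ring_scope.

(** A single Borel map [readout] works for every Y.  The coordinates in
    [2^k, 2^(k+1)) form the k-th block; its first k places are the test and the
    next k places the store.  A block is read when x agrees with y on its test,
    and bit i of the output is 1 when infinitely many of the blocks that are
    read hold a 1 at place i of their store.

    The point is that, for a meager set M and a value z, the output z is reached
    at some x outside M for almost every y ([readout_hits]).  By the
    classical description of meager sets ([meager_avoid]) there are a point c
    and an infinite set of reserved blocks such that whatever agrees with c
    outside the reserved blocks avoids M.  The reserved blocks are therefore
    free: x copies y there on the tests and z on the stores.  Reading goes wrong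
    only at the other blocks, where x is c, and there a block is read only if c
    and y agree on its test.  For a given k this happens with probability
    2^-k, so by Borel-Cantelli it happens finitely often for almost every y
    ([infinitely_many_matches_null]), and finitely many faulty blocks do not
    change the output.  A set that is not null contains such a y.

    The set L is then built in the usual way.  The Continuum Hypothesis gives
    countable sets S a, indexed by points, such that each b lies in all but
    countably many of them ([CH_countable_sections]: initial segments of a
    well-order).  Every meager set is covered by one with a code b in the Cantor
    space ([meager_coded]).  Choosing for each a some x_a outside the meager
    sets with code in S a, together with y in Y such that the output is a, makes
    L = {x_a} a Luzin set and the map onto. *)

(** * Topology of the Cantor space *)

Definition agree (n : nat) (x y : nat -> bool) : Prop :=
  forall i, (i < n)%N -> x i = y i.

Lemma nbhs_agree (x : cantor_space) (n : nat) :
  nbhs x [set y : cantor_space | agree n x y].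
Proof.
elim: n => [|n IH]; first by apply: filterS filterT => y _ i.
have xn : nbhs x [set y : cantor_space | y n = x n].
  apply: (@proj_continuous _ (fun=> bool) n x [set x n]).
  by apply: open_nbhs_nbhs; split => //; exact: discrete_open.
apply: filterS (filterI IH xn) => y [xy yn] i.
by rewrite ltnS leq_eqVlt => /predU1P[->|/xy].
Qed.

(** The cylinders around x form a basis of neighbourhoods: if none of them were
    inside U, points chosen outside U in ever smaller cylinders would converge
    to x coordinatewise, hence in the product topology. *)
Lemma nbhs_cantorP (x : cantor_space) (U : set cantor_space) :
  nbhs x U <-> exists n, [set y : cantor_space | agree n x y] `<=` U.
Proof.
split=> [Ux|[n nU]]; last exact: filterS nU (nbhs_agree x n).
apply: contrapT => H.
have /choice[y yP] : forall n, exists y : cantor_space, agree n x y /\ ~ U y.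
  move=> n; apply: contrapT => Hn; apply: H; exists n => y xy.
  by apply: contrapT => Uy; apply: Hn; exists y.
have yx : y @ \oo --> x.
  apply/cvg_sup => i; apply/cvg_image.
    by rewrite eqEsubset; split => // b _; exists (fun=> b).
  move=> B /= /nbhs_singleton Bx; exists [set z : nat -> bool | B (z i)].
    by exists i.+1 => //= n /= ni; have [+ _] := yP n => <-.
  rewrite eqEsubset; split => [_ [z Bz <-]//|b Bb].
  by exists (fun=> b).
have [N _ /(_ N (leqnn N))] : (y @ \oo) U by exact: yx.
by have [] := yP N.
Qed.

Lemma nowhere_dense_avoid (A : set cantor_space) (x : cantor_space) (a : nat) :
  nowhere_dense A -> exists (y : cantor_space) (b : nat),
    [/\ agree a x y, (a <= b)%N & forall z, agree b y z -> ~ A z].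
Proof.
move=> ndA; apply: contrapT => H.
suff : interior (closure A) x by rewrite ndA.
apply: filterS (nbhs_agree x a) => y xy U /nbhs_cantorP[n nU].
apply: contrapT => AU; apply: H; exists y, (maxn a n); split => //.
  exact: leq_maxl.
move=> z yz Az; apply: AU; exists z; split => //; apply: nU => i ni.
by apply: yz; rewrite leq_max ni orbT.
Qed.

Definition splice (a : nat) (s w : nat -> bool) : cantor_space :=
  fun m => if (m < a)%N then s m else w m.

(** One window of values escapes finitely many nowhere dense sets after finitely
    many beginnings at once: the requirements are met one after the other, each
    time by lengthening the window, which keeps the earlier ones satisfied. *)
Lemma nowhere_dense_avoid_seq (a : nat) (l : seq (nat * cantor_space))
    (F : nat -> set cantor_space) : (forall j, nowhere_dense (F j)) ->
  exists (d : cantor_space) (b : nat), (a <= b)%N /\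
    forall p x, p \in l -> agree b (splice a p.2 d) x -> ~ F p.1 x.
Proof.
move=> ndF; elim: l => [|[j s] l [d [b [ab H]]]].
  by exists (fun=> false), a.
have [y [b' [sy bb' yF]]] := nowhere_dense_avoid _ (splice a s d) b (ndF j).
exists y, b'; split; first exact: leq_trans bb'.
move=> p x; rewrite inE => /predU1P[->/=|pl] px.
  apply: yF => i ib; rewrite -px// /splice; case: ifP => // ia.
  by rewrite -sy ?(leq_trans ia)// /splice ia.
apply: H pl _ => i ib; rewrite -px ?(leq_trans ib)// /splice.
by case: ifP => // ia; rewrite -sy// /splice ia.
Qed.

(** There are only finitely many beginnings of length a, so the window can be
    chosen independently of the beginning. *)
Lemma nowhere_dense_step (F : nat -> set cantor_space) (a i : nat) :
  (forall j, nowhere_dense (F j)) ->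
  exists (d : cantor_space) (b : nat), forall (x : cantor_space) j,
    (forall m, (a <= m < b)%N -> x m = d m) -> (j <= i)%N -> ~ F j x.
Proof.
move=> ndF.
pose l := [seq (j, (fun m => nth false (val t) m) : cantor_space) |
             j <- iota 0 i.+1, t <- enum {: a.-tuple bool}].
have [d [b [ab H]]] := nowhere_dense_avoid_seq a l _ ndF.
exists d, b => x j xd ji.
apply: (H (j, fun m => nth false (mktuple (fun k : 'I_a => x k)) m)).
  apply/allpairsPdep; exists j, [tuple x k | k < a].
  by rewrite mem_iota mem_enum.
move=> m mb; rewrite /splice /=; case: ltnP => [ma|am].
  by rewrite (_ : m = Ordinal ma)// nth_mktuple.
by rewrite xd// am.
Qed.

(** The windows are placed between the reserved blocks n i and n (i + 1), the
    i-th window escaping F 0, ..., F i.  Since windows do not depend on what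
    precedes them, the contents of the reserved blocks are arbitrary. *)
Lemma meager_avoid (F : nat -> set cantor_space) :
  (forall j, nowhere_dense (F j)) ->
  exists (c : cantor_space) (n : nat -> nat), {homo n : i j / (i < j)%N} /\
    forall x : cantor_space,
      (forall k m, ~ (exists i, k = n i) -> (2 ^ k <= m < 2 ^ k.+1)%N ->
        x m = c m) ->
    forall j, ~ F j x.
Proof.
move=> ndF.
have /choice[g gP] : forall p : nat * nat, exists q : cantor_space * nat,
    forall (x : cantor_space) j,
    (forall m, (p.1 <= m < q.2)%N -> x m = q.1 m) -> (j <= p.2)%N -> ~ F j x.
  move=> [a i]; have [d [b H]] := nowhere_dense_step F a i ndF.
  by exists (d, b).
pose n := fix n i := if i is i'.+1 then
  maxn (g (2 ^ (n i').+1, i')%N).2 (n i').+1 else 0%N.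
have n_lt i : (n i < n i.+1)%N by rewrite /= leq_max leqnn orbT.
have n_homo : {homo n : i j / (i < j)%N} by exact: homo_ltn ltn_trans n_lt.
have n_mono : {mono n : i j / (i <= j)%N} by exact: leq_mono.
have n_inc : {mono n : i j / (i < j)%N} by move=> i j; rewrite !ltnNge n_mono.
pose D i := (g (2 ^ (n i).+1, i)%N).1.
(* The intervals [2^(n i + 1), 2^(n (i+1))) are disjoint, so at most one i is
   relevant for each m. *)
pose c : cantor_space := fun m =>
  `[< exists i, (2 ^ (n i).+1 <= m < 2 ^ n i.+1)%N /\ D i m >].
have cD i m : (2 ^ (n i).+1 <= m < 2 ^ n i.+1)%N -> c m = D i m.
  move=> /andP[im mi]; apply/asboolP/idP => [[i' [/andP[im' mi']]]|Dm].
    suff -> : i' = i by [].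
    have : (2 ^ n i < 2 ^ n i'.+1)%N.
      by apply: leq_ltn_trans mi'; apply: leq_trans im; rewrite leq_pexp2l.
    have : (2 ^ n i' < 2 ^ n i.+1)%N.
      by apply: leq_ltn_trans mi; apply: leq_trans im'; rewrite leq_pexp2l.
    by rewrite !ltn_exp2l// !n_inc; lia.
  by exists i; rewrite im mi.
exists c, n; split => // x xc j.
apply: (gP (2 ^ (n j).+1, j)%N x j _ (leqnn j)) => /= m /andP[jm mb].
have mj : (m < 2 ^ n j.+1)%N.
  apply: leq_trans mb _; apply: leq_trans (ltnW (ltn_expl (n j.+1) _)) => //.
  exact: leq_maxl.
rewrite -[RHS](cD j)//; last by rewrite jm mj.
have m0 : (0 < m)%N by apply: leq_trans jm; rewrite expn_gt0.
have /andP[km mk] := trunc_log_bounds (isT : (1 < 2)%N) m0.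
apply: (xc (trunc_log 2 m)); last by rewrite km mk.
move=> [i ki]; rewrite ki in km mk.
have : (2 ^ n i < 2 ^ n j.+1)%N by apply: leq_ltn_trans km _.
have : (2 ^ (n j).+1 < 2 ^ (n i).+1)%N by apply: leq_ltn_trans jm _.
by rewrite !ltn_exp2l// ltnS !n_inc; lia.
Qed.

Lemma open_agreeP (A : set cantor_space) :
  (forall x, A x -> exists n, [set y : cantor_space | agree n x y] `<=` A) ->
  open A.
Proof. by move=> H; rewrite openE => x /H /nbhs_cantorP. Qed.

(** * Null sets for the fair coin measure *)

Lemma measurable_window (c : nat -> bool) (a b a' b' : nat) (c' : nat -> bool) :
  measurable ([set y | (forall i, (a <= i < b)%N -> y i = c i) /\
      forall i, (a' <= i < b')%N -> y i = c' i] : set cantor_borel).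
Proof.
apply: sub_sigma_algebra; apply: open_agreeP => x [xc xc'].
exists (maxn b b') => y xy; split=> i /andP[ai ib].
  by rewrite -xy ?leq_max ?ib// xc// ai.
by rewrite -xy ?leq_max ?ib ?orbT// xc'// ai.
Qed.

(** Prescribing l more bits at a distance m after the beginning s costs a factor
    2^-l: for m = 0 the set is contained in a cylinder, and m decreases when s is
    lengthened by either value of the next bit. *)
Lemma fair_coin_window (R : realType)
    (mu : {measure set cantor_borel -> \bar R}) (hmu : fair_coin_measure mu)
    (c : nat -> bool) (l m : nat) (s : seq bool) :
  (mu [set y | (forall i, (0 <= i < size s)%N -> y i = nth false s i) /\
      forall i, (size s + m <= i < size s + m + l)%N -> y i = c i]
   <= ((2^-1) ^+ (size s + l))%:E)%E.
Proof.
elim: m s => [|m IH] s.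
  pose t := s ++ mkseq (fun j => c (size s + j)%N) l.
  have <- : size t = (size s + l)%N by rewrite size_cat size_mkseq.
  rewrite -hmu; apply: le_measure; rewrite ?inE.
  - exact: measurable_window.
  - apply: sub_sigma_algebra; apply: open_agreeP => x xt.
    by exists (size t) => y xy i it; rewrite -xy// xt.
  - move=> y /= [ys yc] i; rewrite size_cat size_mkseq nth_cat => il.
    case: ltnP => is_; first exact: ys.
    by rewrite nth_mkseq; [rewrite subnKC// yc// addn0 is_ il|lia].
pose E (t : seq bool) : set cantor_borel :=
  [set y | (forall i, (0 <= i < size t)%N -> y i = nth false t i) /\
      forall i, (size t + m <= i < size t + m + l)%N -> y i = c i].
have sub : [set y | (forall i, (0 <= i < size s)%N -> y i = nth false s i) /\
      forall i, (size s + m.+1 <= i < size s + m.+1 + l)%N -> y i = c i]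
    `<=` E (rcons s true) `|` E (rcons s false).
  move=> y /= [ys yc].
  suff Ey : E (rcons s (y (size s))) y.
    by case: (y (size s)) Ey => ?; [left|right].
  split=> i; rewrite size_rcons; last by rewrite addSnnS; exact: yc.
  rewrite /= ltnS leq_eqVlt nth_rcons => /predU1P[->|iz].
    by rewrite ltnn eqxx.
  by rewrite iz ys.
apply: le_trans (le_measure mu _ _ sub) _; rewrite ?inE.
- exact: measurable_window.
- by apply: measurableU; exact: measurable_window.
apply: le_trans (measureU2 _ _ _) _; try exact: measurable_window.
apply: le_trans (leeD (IH _) (IH _)) _.
rewrite !size_rcons -EFinD lee_fin addSn exprS.
set u := 2^-1 ^+ _; lra.
Qed.

Definition matches (x y : nat -> bool) (k : nat) : Prop :=
  forall m, (2 ^ k <= m < 2 ^ k + k)%N -> x m = y m.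

(** The test of block k has k places, so a match has probability at most 2^-k,
    which is summable. *)
Lemma infinitely_many_matches_null (R : realType)
    (mu : {measure set cantor_borel -> \bar R}) (hmu : fair_coin_measure mu)
    (c : nat -> bool) :
  mu.-negligible [set y | forall N, exists2 k, (N <= k)%N & matches c y k].
Proof.
pose F k : set cantor_borel := [set y | matches c y k].
have FE k : F k = [set y |
    (forall i, (0 <= i < 0)%N -> y i = nth false [::] i) /\
      forall i, (0 + 2 ^ k <= i < 0 + 2 ^ k + k)%N -> y i = c i].
  apply/seteqP; split=> y; rewrite /F/= !add0n.
    by move=> cy; split=> // i /cy.
  by move=> [_ yc] i /yc.
have mF k : measurable (F k) by rewrite FE; exact: measurable_window.
exists (lim_sup_set F); split;
  last by move=> y /= H N _; have [k Nk yk] := H N; exists k.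
- by apply: bigcap_measurable => // k _; exact: bigcup_measurable.
- apply: lim_sup_set_cvg0 => //.
  apply: (@le_lt_trans _ _ 2%:E); last by rewrite ltry.
  apply: le_trans (@epsilon_trick0 R 2 xpredT _); last by [].
  apply: lee_nneseries => [k *|k *]; first exact: measure_ge0.
  rewrite FE; apply: le_trans (fair_coin_window R mu hmu c k (2 ^ k)%N [::]) _.
  by rewrite lee_fin natrX exprS invfM mulrA divff// mul1r exprVn.
Qed.

(** * The Borel map *)

Definition readout (p : cantor_space * cantor_space) : cantor_space := fun i =>
  `[< forall N, exists k,
      [/\ (N <= k)%N, matches p.1 p.2 k & p.1 (2 ^ k + k + i)%N] >].

(** For each N, some block k >= N is read with a 1 at place i on an open set of
    pairs, because this involves finitely many coordinates; the coordinate is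
    thus the indicator of a countable intersection of open sets. *)
Lemma readout_coordinate_borel (i : nat) :
  <<s @open (cantor_space * cantor_space)%type >> [set p | readout p i].
Proof.
rewrite (_ : [set p | _] = ~` \bigcup_N ~` \bigcup_(k >= N)
    [set p : cantor_space * cantor_space |
       matches p.1 p.2 k /\ p.1 (2 ^ k + k + i)%N]).
  apply: sigma_algebraC; apply: sigma_algebra_bigcup => N.
  apply: sigma_algebraC; apply: sub_sigma_algebra.
  apply: bigcup_open => k _; rewrite openE => -[x y] /= [xy xi].
  exists ([set x' | agree (2 ^ k + k + i).+1 x x'],
          [set y' | agree (2 ^ k + k) y y']).
    by split; exact: nbhs_agree.
  move=> [x' y'] /= [xx' yy']; split; last by rewrite -xx'.
  move=> m /andP[km mk].
  by rewrite -xx' ?(leq_trans mk) ?leqW ?leq_addr// -yy'// xy// km.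
apply/seteqP; split=> p /=.
  by move=> /asboolP H [N _]; apply; have [k [Nk pk pi]] := H N; exists k.
move=> H; apply/asboolP => N; apply: contrapT => Hk; apply: H; exists N => //.
by move=> [k Nk [pk pi]]; apply: Hk; exists k.
Qed.

(** Open sets are countable unions of cylinders, and a cylinder is a countable
    intersection of conditions on single coordinates. *)
Lemma borel_preimage_cantor (T : topologicalType) (f : T -> cantor_space) :
  (forall i, <<s @open T >> [set p | f p i]) ->
  forall B, <<s @open cantor_space >> B -> <<s @open T >> (f @^-1` B).
Proof.
move=> fm.
have sC A : <<s @open T >> A -> <<s @open T >> (~` A).
  by rewrite -setTD; exact: sigma_algebraCD.
have fagree n (z : nat -> bool) : <<s @open T >> [set p | agree n z (f p)].
  rewrite (_ : [set p | _] = ~` \bigcup_i ~`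
     (if (i < n)%N then
        if z i then [set p | f p i] else ~` [set p | f p i]
      else setT)).
    apply: (sC); apply: sigma_algebra_bigcup => i.
    apply: (sC).
    case: ifP => // _; last by apply: sub_sigma_algebra; exact: openT.
    by case: (z i) => //; apply: (sC).
  apply/seteqP; split=> p /=.
    move=> H [i _]; apply; case: ifP => // ni; have zf := H _ ni.
    by rewrite zf; case: ifP => //= fi; rewrite fi.
  move=> H i ni; apply: contrapT => zf; apply: H; exists i => //; rewrite ni.
  by move: zf; case: (z i) => /=; case: (f p i) => // _; apply.
suff H : <<s @open cantor_space >> `<=` image_set_system setT f <<s @open T >>.
  by move=> B /H; rewrite /image_set_system/= setTI.
apply: smallest_sub; first exact/sigma_algebra_image/smallest_sigma_algebra.
move=> U oU; rewrite /image_set_system/= setTI.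
pose s k : seq bool := odflt [::] (unpickle k).
rewrite (_ : f @^-1` U = \bigcup_k
   if `[< [set y | agree (size (s k)) (nth false (s k)) y] `<=` U >] then
     [set p | agree (size (s k)) (nth false (s k)) (f p)] else set0).
  apply: sigma_algebra_bigcup => k; case: ifP => _; first exact: fagree.
  exact: (@sigma_algebra0 _ setT (@open T)).
apply/seteqP; split=> p /=; last by move=> [k _]; case: asboolP => // sU /sU.
move=> Up; have /nbhs_cantorP[n nU] : nbhs (f p) U by exact: open_nbhs_nbhs.
exists (pickle (mkseq (f p) n)) => //; rewrite /s pickleK/= asboolT.
  by move=> i; rewrite size_mkseq => ni; rewrite nth_mkseq.
move=> y sy; apply: nU => i ni.
by have := sy i; rewrite size_mkseq nth_mkseq// => ->.
Qed.

(** The sets whose trace on A is in the sigma-algebra generated by the relatively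
    open sets form a sigma-algebra containing the open sets. *)
Lemma borel_on_borel (T U : topologicalType) (A : set T) (f : T -> U) :
  (forall B, <<s @open U >> B -> <<s @open T >> (f @^-1` B)) -> borel_on A f.
Proof.
move=> fB B /fB; move: (f @^-1` B) => C.
suff H : <<s @open T >> `<=` image_set_system A id
    <<s A, [set A `&` V | V in @open T] >> by exact: H.
apply: smallest_sub; first exact/sigma_algebra_image/smallest_sigma_algebra.
by move=> V oV; apply: sub_sigma_algebra; exists V.
Qed.

(** The null set of exceptional y depends on F only, through c, whereas x
    depends on y and z as well. *)
Lemma readout_hits (F : nat -> set cantor_space) :
  (forall j, nowhere_dense (F j)) ->
  exists c : cantor_space, forall y : cantor_space,
    ~ (forall N, exists2 k, (N <= k)%N & matches c y k) ->
    forall z : cantor_space, exists x, readout (x, y) = z /\ forall j, ~ F j x.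
Proof.
move=> /meager_avoid[c [n [n_homo nF]]]; exists c => y ycF z.
have n_ge i : (i <= n i)%N.
  by elim: i => // i IH; apply: leq_ltn_trans IH (n_homo _ _ _).
pose x : cantor_space := fun m => let k := trunc_log 2 m in
  if `[< exists i, k = n i >] then
    if (m - 2 ^ k < k)%N then y m else z (m - 2 ^ k - k)%N
  else c m.
have log k j : (j < 2 ^ k)%N -> trunc_log 2 (2 ^ k + j) = k.
  by move=> jk; apply: trunc_log_eq => //; rewrite expnS; lia.
(* x is not in any F j because it agrees with c outside the reserved blocks. *)
exists x; split; last first.
  apply: nF => k m nk /(trunc_log_eq (isT : (1 < 2)%N)) mk.
  by rewrite /x mk asboolF.
have k2 k : (k < 2 ^ k)%N by exact: ltn_expl.
have x_match i : matches x y (n i).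
  move=> m /andP[km mk]; have -> : m = (2 ^ n i + (m - 2 ^ n i))%N by lia.
  rewrite /x log; last by have := k2 (n i); lia.
  by rewrite asboolT; [case: ifP => //; lia|exists i].
have x_store k i : (i + k < 2 ^ k)%N -> (exists j, k = n j) ->
    x (2 ^ k + k + i)%N = z i.
  move=> ik kn; rewrite /x -addnA log; last lia.
  by rewrite asboolT//; case: ifP => [|_]; [lia|congr z; lia].
(* Place i of the store exists as soon as i < k. *)
have large i k : (i < k)%N -> (i + k < 2 ^ k)%N.
  by case: k => // k ik; rewrite expnS; have := k2 k; lia.
have [K KP] : exists K, forall k, (K <= k)%N -> ~ matches c y k.
  apply: contrapT => H; apply: ycF => N; apply: contrapT => HN; apply: H.
  by exists N => k Nk ck; apply: HN; exists k.
apply/funext => i.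
apply/asboolP/idP => [/(_ (maxn K i.+1)) [k [+ xyk xki]]|zi N].
  rewrite geq_max => /andP[Kk ik].
  have [kn|nk] := pselect (exists j, k = n j).
    by rewrite -(x_store k)// large.
  (* An unreserved block beyond K that is read would be a match of c and y. *)
  case: (KP k Kk) => m /andP[km mk]; have /= <- := xyk m; last by rewrite km.
  have -> : m = (2 ^ k + (m - 2 ^ k))%N by lia.
  by rewrite /x log ?asboolF//; have := k2 k; lia.
exists (n (maxn N i.+1)); split => //=.
  by apply: leq_trans (n_ge _); exact: leq_maxl.
rewrite x_store//; last by exists (maxn N i.+1).
have := n_ge (maxn N i.+1); rewrite geq_max => /andP[_ ?].
exact: large.
Qed.

(** * Consequences of the Continuum Hypothesis *)

Lemma countable_setD1 (T : Type) (A : set T) (a : T) :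
  countable (A `\` [set a]) -> countable A.
Proof.
move=> cA; apply: (@sub_countable _ _ _ ((A `\` [set a]) `|` [set a])).
  apply: subset_card_le => x Ax.
  by have [->|xa] := pselect (x = a); [right|left].
rewrite -bigcup2E; apply: bigcup_countable => // -[|[|]] //= _.
Qed.

(** S a is the initial segment below a in an order whose initial segments are
    countable.  If a given well-order has an uncountable initial segment, then
    the least such segment, deprived of its last element, is equipotent to the
    whole space under the hypothesis, and its order is transported along the
    bijection. *)
Lemma CH_countable_sections : continuum_hypothesis ->
  exists S : (nat -> bool) -> set (nat -> bool),
    (forall a, countable (S a)) /\ forall b, countable [set a | ~ S a b].
Proof.
move=> CH; have [R wo] := well_ordering_principle (nat -> bool).
have woT : wo_chain R predT by exact: withinW.
have minR (A : set (nat -> bool)) : A !=set0 ->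
    exists2 m, A m & forall a, A a -> R m a.
  move=> [a Aa]; have [|m [[Am mA] _]] := wo (mem A).
    by exists a; rewrite inE.
  by exists m => [|b Ab]; [rewrite inE in Am|apply: mA; rewrite inE].
have Rtotal a b : R a b \/ R b a by apply/orP; exact: (wo_chainW woT).
have Ranti a b : R a b -> R b a -> a = b.
  by move=> ab ba; apply: (wo_chain_antisymmetric woT) => //; rewrite ab.
have transfer (g : (nat -> bool) -> nat -> bool) : injective g ->
    (forall a, countable [set b | R b (g a)]) ->
    exists S : (nat -> bool) -> set (nat -> bool),
    (forall a, countable (S a)) /\ forall b, countable [set a | ~ S a b].
  move=> ginj gc.
  have pre a : countable [set b | R (g b) (g a)].
    have /countable_injP[f finj] := gc a; apply/countable_injP; exists (f \o g).
    move=> b b'; rewrite !inE => /= ab ab' fbb'.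
    by apply: ginj; apply: finj; rewrite ?inE.
  exists (fun a => [set b | R (g b) (g a)]); split => // b.
  apply: sub_countable (pre b); apply: subset_card_le => a /= nba.
  by have [] := Rtotal (g a) (g b).
have [allc|] := pselect (forall a, countable [set b | R b a]).
  exact: (transfer id).
move=> /existsNP unc.
have [m mc mmin] := minR [set a | ~ countable [set b | R b a]] unc.
pose I := [set b | R b m] `\` [set m].
have [cI|] := CH I; first by case: mc; exact: countable_setD1 cI.
rewrite card_eq_sym => /card_set_bijP[g [gI ginj _]].
apply: (transfer g) => [a b ab|a]; first by apply: ginj; rewrite ?inE.
have [gam gm] := gI a Logic.I.
apply: contrapT => ga; apply: gm => /=; apply: Ranti => //; exact: mmin.
Qed.

(** * Codes for meager sets *)

(** Closed sets are the sets of branches of trees of finite binary words; r lists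
    the pairs (n, s) such that the word s is off the n-th tree. *)
Definition branches (r : nat -> bool) (n : nat) : set cantor_space :=
  [set x : cantor_space | forall m, ~~ r (pickle (n, mkseq x m))].

(** Trees whose branches are not nowhere dense are discarded, so that every r is
    a code. *)
Definition coded (r : nat -> bool) (n : nat) : set cantor_space :=
  if `[< nowhere_dense (branches r n) >] then branches r n else set0.

Lemma coded_nowhere_dense r n : nowhere_dense (coded r n).
Proof.
rewrite /coded; case: asboolP => // _.
by rewrite /nowhere_dense closure0 interior0.
Qed.

(** The n-th tree consists of the words that begin a point of the n-th nowhere
    dense set; its branches form the closure of that set. *)
Lemma meager_coded (M : set cantor_space) :
  meager M -> exists r, M `<=` \bigcup_n coded r n.
Proof.
move=> [F ndF ->].
pose r k := let p := odflt (0%N, [::]) (unpickle k) in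
  ~~ `[< exists2 y, F p.1 y & mkseq y (size p.2) = p.2 >].
have rE n x m : ~~ r (pickle (n, mkseq x m)) <-> exists2 y, F n y & agree m y x.
  rewrite /r pickleK/= negbK size_mkseq; split.
    move=> /asboolP[y Fy yx]; exists y => // i im.
    by move: (congr1 (nth false ^~ i) yx); rewrite !nth_mkseq.
  move=> [y Fy yx]; apply/asboolP; exists y => //.
  by apply/eq_in_map => i; rewrite mem_iota => /yx.
exists r => x [n _ Fx]; exists n => //; rewrite /coded asboolT.
  by move=> m; apply/rE; exists x.
have sub : branches r n `<=` closure (F n).
  move=> y yr U /nbhs_cantorP[m mU]; have /rE[z Fz zy] := yr m.
  by exists z; split => //; apply: mU => i im; rewrite zy.
rewrite /nowhere_dense -subset0 -(ndF n); apply: interiorS.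
rewrite [X in _ `<=` X](closure_id _).1; last exact: closed_closure.
exact: closureS.
Qed.

(** * The theorem *)

Theorem corollary5p10 (R : realType)
    (mu : {measure set cantor_borel -> \bar R}) (hmu : fair_coin_measure mu)
    (CH : continuum_hypothesis) (Y : set cantor_space)
    (hY : ~ mu.-negligible Y) :
  exists L : set cantor_space, luzin_set L /\
    exists f : cantor_space * cantor_space -> cantor_space,
      borel_on (L `*` Y) f /\ f @` (L `*` Y) = [set: cantor_space].
Proof.
have [S [S_countable S_cocountable]] := CH_countable_sections CH.
have /choice[X XP] : forall a : cantor_space, exists x : cantor_space,
    (exists2 y, Y y & readout (x, y) = a) /\ forall b n, S a b -> ~ coded b n x.
  move=> a; have /pcard_surjP[e Se] := S_countable a.
  pose F k := let p := odflt (0%N, 0%N) (unpickle k) in coded (e p.1) p.2.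
  have [c cP] := readout_hits F (fun k => coded_nowhere_dense _ _).
  have [y Yy ycF] : exists2 y, Y y &
      ~ (forall N, exists2 k, (N <= k)%N & matches c y k).
    apply: contrapT => H; apply: hY.
    apply: negligibleS (infinitely_many_matches_null R mu hmu c) => y Yy.
    by apply: contrapT => yc; apply: H; exists y.
  have [x [xya xF]] := cP y ycF a.
  exists x; split; first by exists y.
  move=> b n /Se[i _ <-]; have := xF (pickle (i, n)).
  by rewrite /F pickleK.
exists (range X); split.
  move=> M /meager_coded[b Mb].
  apply: (@sub_countable _ _ _ (X @` [set a | ~ S a b])).
    apply: subset_card_le => _ [[a _ <-] /Mb[n _ ban]]; exists a => //= ab.
    by have [_ /(_ b n ab)] := XP a.
  exact: sub_countable (card_image_le _ _) (S_cocountable b).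
exists readout; split.
  apply: borel_on_borel => B; apply: borel_preimage_cantor => i.
  exact: readout_coordinate_borel.
apply/seteqP; split=> // a _; have [[y Yy xya] _] := XP a.
by exists (X a, y) => //; split => //; exists a.
Qed.
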